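(* Let $\mathbf{J}=-\mathbf{J}^T\in\mathbb{R}^{n,n}$, let $\mathbf{R}=\mathbf{R}^T\in\mathbb{R}^{n,n}$ be positive semi-definite, let $\mathbf{B}_i\in\mathbb{R}^{n_i,m}$ for $i=1,2,3$, with $n=n_1+n_2+n_3$, and let $H=H(z_1,z_2)$ be a (continuously differentiable) energy function on $\mathbb{R}^{n_1}\times\mathbb{R}^{n_2}$. Consider the system $$\begin{bmatrix}\partial_{z_1}H\\ \dot z_2\\ 0\end{bmatrix}=(\mathbf{J}-\mathbf{R})\begin{bmatrix}\dot z_1\\ \partial_{z_2}H\\ z_3\end{bmatrix}+\begin{bmatrix}\mathbf{B}_1\\ \mathbf{B}_2\\ \mathbf{B}_3\end{bmatrix}u,\qquad y=\begin{bmatrix}\mathbf{B}_1^T&\mathbf{B}_2^T&\mathbf{B}_3^T\end{bmatrix}\begin{bmatrix}\dot z_1\\ \partial_{z_2}H\\ z_3\end{bmatrix}.$$ Then along every solution $z=[z_1;z_2;z_3]$ (with $z_1,z_2$ differentiable in time) with input $u$ and output $y$, the energy satisfies $$\frac{\mathrm d}{\mathrm dt}H\le\langle y,u\rangle .$$ In particular, the system is energy dissipative for $u=0$, i.e. $\frac{\mathrm d}{\mathrm dt}H\le 0$ in that case.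
   Context: The state is $z=[z_1;z_2;z_3]\in\mathbb{R}^{n_1+n_2+n_3}$ (column vectors stacked vertically), a function of time; a dot denotes the time derivative. The energy $H$ depends only on $z_1,z_2$ and not on $z_3$. $\partial_{z_1}H\in\mathbb{R}^{n_1}$ and $\partial_{z_2}H\in\mathbb{R}^{n_2}$ denote the partial gradients of $H$ (as column vectors), evaluated along the solution at $(z_1(t),z_2(t))$. $u$ and $y$ are the $\mathbb{R}^m$-valued input and output functions of time. $\langle x,y\rangle=x^Ty$ is the Euclidean inner product. $\frac{\mathrm d}{\mathrm dt}H$ means $\frac{\mathrm d}{\mathrm dt}H(z_1(t),z_2(t))$. Any of the dimensions $n_1,n_2,n_3$ may be zero. *)

(* Defs.v *)
From HB Require Import structures.
From mathcomp Require Import all_boot all_order all_algebra.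
From mathcomp Require Import all_classical all_reals all_analysis.

Set Implicit Arguments.
Unset Strict Implicit.
Unset Printing Implicit Defensive.

Import Order.TTheory GRing.Theory Num.Theory.
Import numFieldNormedType.Exports.

Local Open Scope classical_set_scope.
Local Open Scope ring_scope.

(* The library's [derivable _ _ 1] and [derive1] are two-sided. The versions
   below only use increments that stay in the time interval [I], so they become
   one-sided at an endpoint belonging to [I]; in the interior of [I] they
   coincide with the library's notions (lemmas [derivable_onE] and
   [derive_onE]). *)
Section derivative_on_interval.
Context {K : realType} {V : normedModType K}.
Implicit Types (I : set K) (f : K -> V) (t : K).

Definition derivable_on I f t : Prop :=
  cvg ((fun h : K => h^-1 *: (f (h + t) - f t))
    @ within [set h | I (h + t)] 0^').

Definition derive_on I f t : V :=
  lim ((fun h : K => h^-1 *: (f (h + t) - f t))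
    @ within [set h | I (h + t)] 0^').

Lemma within_dnbhs_interior I t : I° t ->
  within [set h | I (h + t)] (0^' : set_system K) = 0^'.
Proof.
move=> It; have shift_cvg : (fun h : K => h + t) @ (0 : K) --> t.
  by rewrite -[X in _ --> X]add0r; apply: cvgD; [exact: cvg_id|exact: cvg_cst].
have nI : \forall h \near (0 : K)^', I (h + t).
  by apply: nbhs_dnbhs; exact: shift_cvg It.
apply/seteqP; split=> A; rewrite /within/= => HA; last exact: filterS HA.
by near=> h; apply: (near HA h) => //; near: h.
Unshelve. all: by end_near. Qed.

Lemma derivable_onE I f t : I° t -> derivable_on I f t = derivable f t 1.
Proof.
move=> It; rewrite /derivable_on /derivable within_dnbhs_interior//.
by under [in RHS]eq_fun do rewrite /= [_ *: 1]mulr1.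
Qed.

Lemma derive_onE I f t : I° t -> derive_on I f t = derive1 f t.
Proof. by move=> It; rewrite /derive_on within_dnbhs_interior. Qed.

End derivative_on_interval.

Section energy.
Context {K : realType} {n1 n2 : nat}.
Implicit Types (H : 'cV[K]_n1 * 'cV[K]_n2 -> K) (x : 'cV[K]_n1 * 'cV[K]_n2).

Definition grad1 H x : 'cV[K]_n1 :=
  \col_i 'D_(delta_mx i 0) (fun w : 'cV[K]_n1 => H (w, x.2)) x.1.

Definition grad2 H x : 'cV[K]_n2 :=
  \col_i 'D_(delta_mx i 0) (fun w : 'cV[K]_n2 => H (x.1, w)) x.2.

Definition continuously_differentiable H : Prop :=
  [/\ forall x, differentiable H x, continuous (grad1 H)
    & continuous (grad2 H)].

End energy.

Definition inner {K : realType} {m : nat} (x y : 'cV[K]_m) : K :=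
  (x^T *m y) 0 0.

Definition psdmx {K : realType} {n : nat} (A : 'M[K]_n) : Prop :=
  forall x : 'cV[K]_n, 0 <= inner x (A *m x).

Section system.
Context {K : realType} {n1 n2 n3 m : nat}.

Definition col3 {p : nat} (A1 : 'M[K]_(n1, p)) (A2 : 'M[K]_(n2, p))
    (A3 : 'M[K]_(n3, p)) : 'M[K]_(n1 + n2 + n3, p) :=
  col_mx (col_mx A1 A2) A3.

(* [z3] is not required to be differentiable, as only its values occur in the
   equations; [u], [y] and the [z]'s only matter on [I]. *)
Definition is_solution (J R : 'M[K]_(n1 + n2 + n3))
    (B1 : 'M[K]_(n1, m)) (B2 : 'M[K]_(n2, m)) (B3 : 'M[K]_(n3, m))
    (H : 'cV[K]_n1 * 'cV[K]_n2 -> K) (I : set K)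
    (u y : K -> 'cV[K]_m)
    (z1 : K -> 'cV[K]_n1) (z2 : K -> 'cV[K]_n2) (z3 : K -> 'cV[K]_n3) : Prop :=
  forall t, I t ->
    let dz1 := derive_on I z1 t in
    let dz2 := derive_on I z2 t in
    let dH1 := grad1 H (z1 t, z2 t) in
    let dH2 := grad2 H (z1 t, z2 t) in
    [/\ derivable_on I z1 t,
        derivable_on I z2 t,
        col3 dH1 dz2 0 = (J - R) *m col3 dz1 dH2 (z3 t) + col3 B1 B2 B3 *m u t
      & y t = row_mx (row_mx B1^T B2^T) B3^T *m col3 dz1 dH2 (z3 t)].

End system.

(* Main.v *)
(** By the chain rule, dH/dt = <z1', grad1 H> + <z2', grad2 H>, which is <v, w>
for v = [z1'; grad2 H; z3] and w = [grad1 H; z2'; 0]. As w = (J - R) v + B u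
and y = B^T v, this equals <v, J v> - <v, R v> + <y, u>; the first term vanishes
by skew-symmetry and the second is nonpositive. *)

Require Import Defs.
From HB Require Import structures.
From mathcomp Require Import all_boot all_order all_algebra.
From mathcomp Require Import all_classical all_reals all_analysis.

Set Implicit Arguments.
Unset Strict Implicit.
Unset Printing Implicit Defensive.

Import Order.TTheory GRing.Theory Num.Theory.
Import numFieldNormedType.Exports.

Local Open Scope classical_set_scope.
Local Open Scope ring_scope.

(** An interval with nonempty interior has a point [a] other than [t], and convexity puts the whole
    segment from [t] to [a] in [I]. Hence there are arbitrarily small nonzero increments staying in
    [I], even at an endpoint. Properness is what makes limits along this filter unique. *)
Lemma within_dnbhs_proper (K : realType) (I : set K) (t : K) :
  is_interval I -> I° !=set0 -> I t ->
  ProperFilter (within [set h | I (h + t)] 0^').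
Proof.
move=> hI [c Ic] It; apply: Build_ProperFilter_ex => A.
rewrite /within /= => -[e /= e0 HA].
have [a [Ia at_]] : exists a, I a /\ a != t.
  (* If the interior point [c] is [t] itself, move by half the radius of a ball around it contained
     in [I]. *)
  have [tc|] := eqVneq c t; last by exists c; split => //; exact: interior_subset Ic.
  move: Ic => [d /= d0 Hd]; exists (c + d / 2); split.
    apply: Hd; rewrite /ball /= opprD addrA subrr add0r normrN gtr0_norm ?divr_gt0//.
    by rewrite ltr_pdivrMr// ltr_pMr// ltr1n.
  by rewrite tc -subr_eq0 addrAC subrr add0r gt_eqF// divr_gt0.
(* The bound 1 keeps [s * (a - t) + t] between [t] and [a]; the other bound makes the increment
   shorter than [e]. *)
pose s := Num.min 1 (e / 2 / `|a - t|).
have at0 : 0 < `|a - t| by rewrite normr_gt0 subr_eq0.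
have s0 : 0 < s by rewrite lt_min ltr01 !divr_gt0.
have s1 : s <= 1 by rewrite ge_min lexx.
have se : s * `|a - t| < e.
  rewrite (@le_lt_trans _ _ (e / 2))//; last by rewrite ltr_pdivrMr// ltr_pMr// ltr1n.
  by rewrite -ler_pdivlMr// ge_min lexx orbT.
exists (s * (a - t)); apply: HA => /=.
- by rewrite sub0r normrN normrM gtr0_norm.
- by rewrite mulf_neq0 ?subr_eq0// gt_eqF.
have [ta|ta] := leP t a.
- apply: (hI t a) => //; apply/andP; split.
    by rewrite lerDr mulr_ge0 ?subr_ge0// ltW.
  by rewrite -lerBrDr ler_piMl ?subr_ge0.
- apply: (hI a t) => //; apply/andP; split.
    by rewrite -lerBlDr -lerN2 -mulrN opprB ler_piMl ?subr_ge0 // ltW.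
  by rewrite gerDr pmulr_rle0// subr_le0 ltW.
Qed.

(** The analytic core of the chain rule, for any proper filter of nonzero increments tending to 0.
    The first-order remainder of [f] is small relative to [h *: q h], and [q] stays bounded because
    it converges, so the remainder divided by [h] vanishes in the limit. *)
Lemma differentiable_cvg_comp (K : realType) (V W : normedModType K)
    (F : set_system K) (FF : ProperFilter F) (f : V -> W) (x d : V)
    (q : K -> V) :
  F `=>` (0 : K)^' -> differentiable f x -> q h @[h --> F] --> d ->
  h^-1 *: (f (h *: q h + x) - f x) @[h --> F] --> 'd f x d.
Proof.
move=> F0 df qd.
have F0' : h @[h --> F] --> (0 : K).
  by apply: cvg_trans F0 _; exact: nbhs_dnbhs.
have hq0 : h *: q h @[h --> F] --> (0 : V).
  by rewrite -(scale0r d); exact: cvgZ.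
have dfq : 'd f x (q h) @[h --> F] --> 'd f x d.
  by apply: continuous_cvg => //; exact: diff_continuous.
suff r0 : h^-1 *: (f (h *: q h + x) - f x) - 'd f x (q h)
    @[h --> F] --> (0 : W).
  have := cvgD r0 dfq; rewrite add0r => r1; refine (cvg_trans _ (r1 _)).
  by apply: near_eq_cvg; near=> h; rewrite /= fctE subrK.
have /eqaddoP fo := diff_locally df.
(* An eventual bound for [q h], which ends up within distance 1 of [d]. It is positive, so the
   remainder estimate can be taken with constant [e / M]. *)
pose M := `|d| + 1.
have M0 : 0 < M by rewrite ltr_wpDl.
apply/cvgr0Pnorm_le => e e0.
have eM0 : 0 < e / M by rewrite divr_gt0.
have {}fo := fo _ eM0.
have qM : \forall h \near F, `|q h| <= M.
  have /cvgrPdist_le/(_ 1 ltr01) := qd.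
  apply: filterS => h; rewrite distrC => hd.
  by rewrite -(subrK d (q h)) (le_trans (ler_normD _ _))// addrC lerD.
have hn0 : \forall h \near F, h != 0 by exact: (F0 _ (withinT _ _)).
near=> h.
have h0 : h != 0 by near: h.
have : `|f (h *: q h + x) - (f x + 'd f x (h *: q h))| <= e / M * `|h *: q h|.
  by near: h; exact: hq0 fo.
rewrite opprD addrA linearZ normrZ mulrCA => fqh.
have -> : h^-1 *: (f (h *: q h + x) - f x) - 'd f x (q h) =
    h^-1 *: (f (h *: q h + x) - f x - h *: 'd f x (q h)).
  by rewrite [RHS]scalerBr scalerA mulVf// scale1r.
rewrite normrZ normfV ler_pdivrMl ?normr_gt0// (le_trans fqh)//.
rewrite ler_wpM2l// -[leRHS](divfK (lt0r_neq0 M0)) ler_wpM2l ?(ltW eM0)//.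
by near: h.
Unshelve. all: by end_near. Qed.

Lemma col_sum_delta (K : pzSemiRingType) (n : nat) (d : 'cV[K]_n) :
  d = \sum_i d i 0 *: delta_mx i 0.
Proof.
by rewrite [LHS]matrix_sum_delta; apply: eq_bigr => i _; rewrite big_ord1.
Qed.

Section gradient.
Context {K : realType} {n1 n2 : nat}.
Variables (H : 'cV[K]_n1 * 'cV[K]_n2 -> K) (x : 'cV[K]_n1 * 'cV[K]_n2).
Hypothesis dH : differentiable H x.

(** A step along [(delta_mx i 0, 0)] leaves [x.2] fixed, so the partial derivative and the
    directional derivative of [H] have the same difference quotients. *)
Lemma grad1E i : grad1 H x i 0 = 'd H x (delta_mx i 0, 0).
Proof.
case: x dH => x1 x2 dHx; rewrite mxE -deriveE// /derive.
congr (lim _); apply: (congr1 (fun g : K -> K => g @ 0^')).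
apply: funext => h /=; congr (_ *: (H _ - _)).
by rewrite -[RHS]/(_, _) /= scaler0 add0r.
Qed.

Lemma grad2E i : grad2 H x i 0 = 'd H x (0, delta_mx i 0).
Proof.
case: x dH => x1 x2 dHx; rewrite mxE -deriveE// /derive.
congr (lim _); apply: (congr1 (fun g : K -> K => g @ 0^')).
apply: funext => h /=; congr (_ *: (H _ - _)).
by rewrite -[RHS]/(_, _) /= scaler0 add0r.
Qed.

Lemma diff_grad (d1 : 'cV[K]_n1) (d2 : 'cV[K]_n2) :
  'd H x (d1, d2) = inner d1 (grad1 H x) + inner d2 (grad2 H x).
Proof.
have -> : (d1, d2) = (d1, 0) + (0, d2) :> 'cV[K]_n1 * 'cV[K]_n2.
  by rewrite -[RHS]/(_, _) /= addr0 add0r.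
rewrite linearD /inner !mxE; congr (_ + _).
- have -> : (d1, 0) =
      \sum_i d1 i 0 *: (delta_mx i 0, 0) :> 'cV[K]_n1 * 'cV[K]_n2.
    (* Expand [d1] in the standard basis and push the additive injection [a] to [(a, 0)] through the
       sum. *)
    rewrite [in LHS](col_sum_delta d1)
      (big_morph (fun a => (a, 0)) (id1 := 0) (op1 := +%R))//.
      by apply: eq_bigr => i _; rewrite -[RHS]/(_, _) /= scaler0.
    by move=> a b; rewrite -[RHS]/(_, _) /= addr0.
  rewrite linear_sum; apply: eq_bigr => i _.
  by rewrite linearZ mxE grad1E.
- have -> : (0, d2) =
      \sum_i d2 i 0 *: (0, delta_mx i 0) :> 'cV[K]_n1 * 'cV[K]_n2.
    rewrite [in LHS](col_sum_delta d2)
      (big_morph (fun a => (0, a)) (id1 := 0) (op1 := +%R))//.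
      by apply: eq_bigr => i _; rewrite -[RHS]/(_, _) /= scaler0.
    by move=> a b; rewrite -[RHS]/(_, _) /= addr0.
  rewrite linear_sum; apply: eq_bigr => i _.
  by rewrite linearZ mxE grad2E.
Qed.

End gradient.

(** A scalar equals its transpose, so skew-symmetry makes this one equal to its own opposite. *)
Lemma inner_skew (K : realType) (n : nat) (J : 'M[K]_n) (x : 'cV[K]_n) :
  J = - J^T -> inner x (J *m x) = 0.
Proof.
move=> hJ; apply/eqP; rewrite -eqNr; apply/eqP.
rewrite /inner -[in RHS](trmxK (x^T *m _)) [RHS]mxE !trmx_mul trmxK.
by rewrite [in LHS]hJ mulNmx mulmxN mxE opprK mulmxA.
Qed.

Section chain_rule.
Context {K : realType} {n1 n2 : nat}.
Variables (H : 'cV[K]_n1 * 'cV[K]_n2 -> K) (I : set K) (t : K).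
Variables (z1 : K -> 'cV[K]_n1) (z2 : K -> 'cV[K]_n2).
Hypotheses (hI : is_interval I) (hI0 : I° !=set0) (It : I t).
Hypothesis dH : differentiable H (z1 t, z2 t).
Hypotheses (dz1 : derivable_on I z1 t) (dz2 : derivable_on I z2 t).

Lemma energy_cvg :
  h^-1 *: (H (z1 (h + t), z2 (h + t)) - H (z1 t, z2 t))
    @[h --> within [set h | I (h + t)] 0^'] -->
  inner (derive_on I z1 t) (grad1 H (z1 t, z2 t)) +
  inner (derive_on I z2 t) (grad2 H (z1 t, z2 t)).
Proof.
have PF := within_dnbhs_proper hI hI0 It.
have W0 : within [set h | I (h + t)] (0 : K)^' `=>` (0 : K)^' by exact: cvg_within.
rewrite -diff_grad//.
(* The pair of difference quotients serves as [q]: multiplied by [h] and added to the state at [t],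
   it gives back the state at [h + t]. *)
have dz : (h^-1 *: (z1 (h + t) - z1 t), h^-1 *: (z2 (h + t) - z2 t))
    @[h --> within [set h | I (h + t)] 0^'] -->
    (derive_on I z1 t, derive_on I z2 t) by exact: (cvg_pair dz1 dz2).
refine (cvg_trans _ (differentiable_cvg_comp PF W0 dH dz)).
apply: near_eq_cvg.
have hn0 : \forall h \near within [set h | I (h + t)] (0 : K)^', h != 0.
  by exact: (W0 _ (withinT _ _)).
apply: filterS hn0 => h h0.
have -> // : h *: (h^-1 *: (z1 (h + t) - z1 t), h^-1 *: (z2 (h + t) - z2 t)) +
  (z1 t, z2 t) = (z1 (h + t), z2 (h + t)).
by rewrite -[LHS]/(_, _) /= !scalerA mulfV// !scale1r !subrK.
Qed.

Lemma derivable_on_energy :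
  derivable_on I (fun s => H (z1 s, z2 s)) t.
Proof. by apply/cvg_ex; eexists; exact: energy_cvg. Qed.

Lemma derive_on_energy :
  derive_on I (fun s => H (z1 s, z2 s)) t =
  inner (derive_on I z1 t) (grad1 H (z1 t, z2 t)) +
  inner (derive_on I z2 t) (grad2 H (z1 t, z2 t)).
Proof.
have PF := within_dnbhs_proper hI hI0 It.
by apply: cvg_lim => //; exact: energy_cvg.
Qed.

End chain_rule.

Theorem lemma2p3 (K : realType) (n1 n2 n3 m : nat)
    (J R : 'M[K]_(n1 + n2 + n3))
    (B1 : 'M[K]_(n1, m)) (B2 : 'M[K]_(n2, m)) (B3 : 'M[K]_(n3, m))
    (H : 'cV[K]_n1 * 'cV[K]_n2 -> K)
    (hJ : J = - J^T) (hR : R = R^T) (hRpsd : psdmx R)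
    (hH : continuously_differentiable H)
    (I : set K) (hI : is_interval I) (hI0 : I° !=set0)
    (u y : K -> 'cV[K]_m)
    (z1 : K -> 'cV[K]_n1) (z2 : K -> 'cV[K]_n2) (z3 : K -> 'cV[K]_n3)
    (hsol : is_solution J R B1 B2 B3 H I u y z1 z2 z3) :
  let energy := fun t : K => H (z1 t, z2 t) in
  (forall t, I t ->
     derivable_on I energy t /\ derive_on I energy t <= inner (y t) (u t)) /\
  ((forall t, I t -> u t = 0) ->
     forall t, I t -> derive_on I energy t <= 0).
Proof.
have diss t : I t -> derivable_on I (fun s => H (z1 s, z2 s)) t /\
    derive_on I (fun s => H (z1 s, z2 s)) t <= inner (y t) (u t).
  move=> It; have [dz1 dz2 eqs ->] := hsol t It.
  have [dH _ _] := hH; split; first exact: derivable_on_energy.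
  rewrite derive_on_energy//.
  set v := col3 _ _ (z3 t) in eqs *.
  (* The zero third block cancels [z3 t], so the energy rate is the pairing of [v] with the
     left-hand side of the system. *)
  have -> : inner (derive_on I z1 t) (grad1 H (z1 t, z2 t)) +
      inner (derive_on I z2 t) (grad2 H (z1 t, z2 t)) =
      inner v (col3 (grad1 H (z1 t, z2 t)) (derive_on I z2 t) 0).
    rewrite /inner /v /col3 !tr_col_mx !mul_row_col mulmx0 addr0 [RHS]mxE.
    congr (_ + _); rewrite !mxE; apply: eq_bigr => i _.
    by rewrite !mxE mulrC.
  rewrite eqs; have -> : row_mx (row_mx B1^T B2^T) B3^T = (col3 B1 B2 B3)^T.
    by rewrite /col3 !tr_col_mx.
  (* The input term of the rate is exactly the supply rate [inner (y t) (u t)]; cancelling it leaves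
     the claim that the quadratic form of [J - R] at [v] is nonpositive. *)
  rewrite /inner trmx_mul trmxK mulmxDr mxE -mulmxA -[leRHS]add0r lerD2r.
  rewrite mulmxBl mulmxBr mxE [X in X + _]inner_skew// add0r mxE oppr_le0.
  exact: hRpsd.
split=> // u0 t It; have [_] := diss t It.
by rewrite u0// /inner mulmx0 mxE.
Qed.
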